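(* Let $X=f^{-1}(0)\subseteq(\mathbb C^n,0)$ be a hypersurface and let $C\subset X$ be an irreducible curve (germ at the origin). Then the fiber of $\mathrm{Projan}(\mathcal R((JM(X)_{D-})|_{C\times C}))$ over the origin $(0,0)$ contains $\mathbb P(\mathrm{Span}(H,L))$, where $H$ is the limiting conormal of $X$ along $C$ and $L$ is the limit, as $x\to 0$ along $C$, of $\hat D_2f_x|_{TC_x}$.
   Context: $JM(X)$ is the Jacobian module of $X$, generated by the partial derivatives $\partial f/\partial z_1,\dots,\partial f/\partial z_n$ in $\mathcal O_X$. With $\pi_1,\pi_2:X\times X\to X$ the projections and $h_D=(h\circ\pi_1,h\circ\pi_2)$, $JM(X)_{D-}\subseteq\mathcal O_{X\times X}^2$ is the submodule generated by $(\partial f/\partial z_1)_D,\dots,(\partial f/\partial z_n)_D$; so its matrix of generators has rows $Df\circ\pi_1$ and $Df\circ\pi_2$. $(\cdot)|_{C\times C}$ denotes restriction to $C\times C$ with the restricted generators. For a module $\mathcal N\subseteq\mathcal O_Y^q$ with generators forming the columns of a $q\times m$ matrix $[\mathcal N]$, $\mathrm{Projan}(\mathcal R(\mathcal N))$ is the closure in $Y\times\mathbb P^{m-1}$ of the set of $(y,[\ell])$ with $[\mathcal N(y)]$ of maximal rank (equal to the generic rank of $\mathcal N$) and $\ell\ne0$ in the row space of $[\mathcal N(y)]$. The points of $C\setminus\{0\}$ near $0$ are smooth points of $X$, with $Df(x)\neq0$. The limiting conormal $H$ of $X$ along $C$ is the limit of the line $\langle Df(x)\rangle\subset\mathbb C^n$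 as $x\to0$, $x\in C\setminus\{0\}$. At a smooth point $x$ of $X$ the second intrinsic derivative $\hat D_2f_x:k_x\to C_x$, with $k_x=\ker Df_x$ and $C_x=\mathrm{coker}(Df_x)$, is obtained by restricting the second derivative $D_2f$ at $x$ to $k_x$ and projecting to $C_x$; it can be viewed as a map from $k_x$ to $\mathbb C^n$ defined only up to multiples of $\nabla f(x)$. Accordingly, $\mathrm{Span}(H,L)$ is understood as the limit, as $x\to0$ along $C\setminus\{0\}$, of the linear subspaces $\mathrm{Span}(Df(x),\,D_2f_x(TC_x))\subseteq\mathbb C^n$. *)

(* Defs.v *)
From HB Require Import structures.
From mathcomp Require Import all_boot all_order all_algebra.
From mathcomp Require Import complex.
From mathcomp Require Import all_classical all_reals all_analysis.

Set Implicit Arguments.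
Unset Strict Implicit.
Unset Printing Implicit Defensive.

Import Order.TTheory GRing.Theory Num.Theory.
Import numFieldNormedType.Exports.

Local Open Scope classical_set_scope.
Local Open Scope ring_scope.

(* The definitions are written for any numFieldType K and are meant for
   K = CC R, the complex numbers.  The topology of R[i] is found through the
   coercion from numFieldType, hence the name CC.  Points of C^n and
   covectors (Df(x), rows of a matrix of generators) are both row vectors.
   Germs at 0 are handled through representatives: functions and subsets
   of C^n, constrained only near 0. *)

Definition CC (R : realType) : numFieldType := R[i]%C.

(** * Holomorphic functions and maps *)

(* Multi-indices are finite functions to nat; the N-th partial sum runs over
   the multi-indices with all components < N. *)
Definition mono (K : numFieldType) (n : nat) (h : 'rV[K]_n)
    (al : {ffun 'I_n -> nat}) : K :=
  \prod_(i < n) h 0 i ^+ al i.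

Definition psum (K : numFieldType) (n : nat)
    (t : {ffun 'I_n -> nat} -> K) (N : nat) : K :=
  \sum_(al : {ffun 'I_n -> 'I_N}) t [ffun i => al i : nat].

Definition has_power_series_at (K : numFieldType) (n : nat)
    (f : 'rV[K]_n -> K) (x : 'rV[K]_n) : Prop :=
  exists a : {ffun 'I_n -> nat} -> K,
    \forall h \near (0 : 'rV[K]_n),
      (exists M : K, forall N, psum (fun al => `|a al * mono h al|) N <= M) /\
      psum (fun al => a al * mono h al) @ \oo --> f (x + h).

Definition holomorphic_near (K : numFieldType) (n : nat)
    (f : 'rV[K]_n -> K) (x : 'rV[K]_n) : Prop :=
  \forall y \near x, has_power_series_at f y.

Definition holomorphic_map_near (K : numFieldType) (m n : nat)
    (phi : 'rV[K]_m -> 'rV[K]_n) (x : 'rV[K]_m) : Prop :=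
  forall j, holomorphic_near (fun y => phi y 0 j) x.

(** * Analytic germs at the origin *)

Definition germ_eq (K : numFieldType) (n : nat) (A B : set 'rV[K]_n) : Prop :=
  \forall x \near (0 : 'rV[K]_n), A x <-> B x.

Definition germ_sub (K : numFieldType) (n : nat) (A B : set 'rV[K]_n) : Prop :=
  \forall x \near (0 : 'rV[K]_n), A x -> B x.

Definition analytic_germ (K : numFieldType) (n : nat)
    (A : set 'rV[K]_n) : Prop :=
  exists (k : nat) (g : 'I_k -> 'rV[K]_n -> K),
    (forall i, holomorphic_near (g i) 0) /\
    germ_eq A [set x | forall i, g i x = 0].

Definition irreducible_germ (K : numFieldType) (n : nat)
    (A : set 'rV[K]_n) : Prop :=
  [/\ analytic_germ A, A 0 &
      forall A1 A2 : set 'rV[K]_n, analytic_germ A1 -> analytic_germ A2 ->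
        germ_eq A (A1 `|` A2) -> germ_eq A A1 \/ germ_eq A A2].

(* A is, near its point x, an embedded complex submanifold of dimension d:
   phi is a holomorphic immersion and a homeomorphism from V onto A `&` U,
   with inverse psi. *)
Definition regular_point (K : numFieldType) (n : nat) (A : set 'rV[K]_n)
    (d : nat) (x : 'rV[K]_n) : Prop :=
  A x /\
  exists (U : set 'rV[K]_n) (V : set 'rV[K]_d)
         (phi : 'rV[K]_d -> 'rV[K]_n) (psi : 'rV[K]_n -> 'rV[K]_d),
    [/\ open U /\ U x, open V,
        forall v, V v -> holomorphic_map_near phi v /\ row_free ('J phi v),
        phi @` V = A `&` U &
        (forall v, V v -> psi (phi v) = v) /\
        {within A `&` U, continuous psi}].

(* dim_0 A = limsup of dim_x A as x tends to 0 among the regular points. *)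
Definition germ_dim (K : numFieldType) (n : nat) (A : set 'rV[K]_n)
    (d : nat) : Prop :=
  (\forall x \near (0 : 'rV[K]_n), forall k, regular_point A k x -> (k <= d)%N) /\
  (forall U : set 'rV[K]_n, nbhs (0 : 'rV[K]_n) U ->
     exists2 x, U x & regular_point A d x).

Definition irreducible_curve_germ (K : numFieldType) (n : nat)
    (C : set 'rV[K]_n) : Prop :=
  irreducible_germ C /\ germ_dim C 1.

(* X = f^-1(0): f is a nonzero germ vanishing at the origin. *)
Definition hypersurface_equation (K : numFieldType) (n : nat)
    (f : 'rV[K]_n -> K) : Prop :=
  [/\ holomorphic_near f 0, f 0 = 0 &
      ~ \forall x \near (0 : 'rV[K]_n), f x = 0].

(* Velocities at x of holomorphic arcs of A; at a regular point this is the
   tangent space of the manifold A. *)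
Definition tangent_space (K : numFieldType) (n : nat) (A : set 'rV[K]_n)
    (x : 'rV[K]_n) : set 'rV[K]_n :=
  [set v | exists gam : 'rV[K]_1 -> 'rV[K]_n,
     [/\ holomorphic_map_near gam 0, gam 0 = x,
         \forall t \near (0 : 'rV[K]_1), A (gam t) & v = 'J gam 0]].

(** * First and second derivatives *)

(* Df(x), which is also the 1 x n matrix of generators of JM(X) at x. *)
Definition Df (K : numFieldType) (n : nat) (f : 'rV[K]_n -> K)
    (x : 'rV[K]_n) : 'rV[K]_n :=
  \row_(i < n) 'D_('e_i) f x.

(* The points of C \ {0} near 0 are smooth points of X, with Df(x) != 0. *)
Definition smooth_along (K : numFieldType) (n : nat) (f : 'rV[K]_n -> K)
    (C : set 'rV[K]_n) : Prop :=
  \forall x \near (0 : 'rV[K]_n), C x -> x != 0 -> Df f x != 0.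

(* D_2f_x(v) is the row vector v *m D2f f x, the derivative of Df along v. *)
Definition D2f (K : numFieldType) (n : nat) (f : 'rV[K]_n -> K)
    (x : 'rV[K]_n) : 'M[K]_n :=
  \matrix_(i < n, j < n) 'D_('e_i) (fun y => 'D_('e_j) f y) x.

(* Span(Df(x), D_2f_x(T_xC)); since T_xC is a linear subspace when x is a
   regular point, the sums below do form the span. *)
Definition conormal_span (K : numFieldType) (n : nat) (f : 'rV[K]_n -> K)
    (C : set 'rV[K]_n) (x : 'rV[K]_n) : set 'rV[K]_n :=
  [set l | exists (a : K) (w : 'rV[K]_n),
     tangent_space C x w /\ l = a *: Df f x + w *m D2f f x].

(* The subspaces V x tend to S as x tends to 0 along C \ {0}: the Hausdorff
   distance between the unit spheres of V x and S tends to 0, i.e. V x tends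
   to S in the Grassmannian. *)
Definition subspace_limit (K : numFieldType) (n : nat) (C : set 'rV[K]_n)
    (V : 'rV[K]_n -> set 'rV[K]_n) (S : {vspace 'rV[K]_n}) : Prop :=
  forall e : K, 0 < e ->
    \forall x \near (0 : 'rV[K]_n), C x -> x != 0 ->
      (forall u, V x u -> `|u| = 1 -> exists2 s, s \in S & `|u - s| < e) /\
      (forall s, s \in S -> `|s| = 1 -> exists2 u, V x u & `|s - u| < e).

(* S = Span(H, L).  The condition is stated for all x in C \ {0} near 0
   because an irreducible curve germ is regular there. *)
Definition is_SpanHL (K : numFieldType) (n : nat) (f : 'rV[K]_n -> K)
    (C : set 'rV[K]_n) (S : {vspace 'rV[K]_n}) : Prop :=
  subspace_limit C (conormal_span f C) S.

(** * Modules given by a matrix of generators, doubles and Projan *)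

(* The columns of N y are the values at y of the generators of a submodule of
   O_Y^q; restriction to a subset keeps N and replaces Y. *)
Definition doubleD (T : Type) (K : numFieldType) (q m : nat)
    (N : T -> 'M[K]_(q, m)) (y : T * T) : 'M[K]_(q + q, m) :=
  col_mx (N y.1) (N y.2).

(* The matrix of generators of JM(X)_{D-}: rows Df o pi_1 and Df o pi_2. *)
Definition JM_D (K : numFieldType) (n : nat) (f : 'rV[K]_n -> K) :
    'rV[K]_n * 'rV[K]_n -> 'M[K]_(1 + 1, n) :=
  doubleD (Df f).

(* r is the generic rank of N on the germ of Y at b. *)
Definition generic_rank (T : topologicalType) (K : numFieldType) (q m : nat)
    (Y : set T) (b : T) (N : T -> 'M[K]_(q, m)) (r : nat) : Prop :=
  (\forall y \near b, Y y -> (\rank (N y) <= r)%N) /\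
  (forall U : set T, nbhs b U -> exists y, [/\ U y, Y y & \rank (N y) = r]).

(* Projan(R(N)) for N on the germ of Y at b.  The subset of Y x P^(m-1) is
   given in homogeneous coordinates: (y, [l]) belongs to it iff (y, l) does,
   where l != 0.  As the quotient map from K^m \ {0} to P^(m-1) is open,
   closure commutes with passing to homogeneous coordinates. *)
Definition Projan (T : topologicalType) (K : numFieldType) (q m : nat)
    (Y : set T) (b : T) (N : T -> 'M[K]_(q, m)) : set (T * 'rV[K]_m) :=
  [set p | [/\ Y p.1, p.2 != 0 &
     closure [set z : T * 'rV[K]_m |
       [/\ Y z.1, generic_rank Y b N (\rank (N z.1)),
           z.2 != 0 & (z.2 <= N z.1)%MS]] p]].

Definition fiber (T : Type) (K : numFieldType) (m : nat)
    (P : set (T * 'rV[K]_m)) (b : T) : set 'rV[K]_m :=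
  [set l | P (b, l)].

(* P(S), again in homogeneous coordinates. *)
Definition projectivization (K : numFieldType) (m : nat)
    (S : {vspace 'rV[K]_m}) : set 'rV[K]_m :=
  [set l | l \in S /\ l != 0].

(* Main.v *)
Require Import Defs.
From HB Require Import structures.
From mathcomp Require Import all_boot all_order all_algebra.
From mathcomp Require Import complex.
From mathcomp Require Import all_classical all_reals all_analysis.
From mathcomp Require Import ring.

(* Let x be a point of C near 0 and u = a Df(x) + w D_2f(x), with w the velocity
   at t = 0 of an arc gam of C through x.  Since Df is differentiable at x, u is
   the limit as t -> 0 of q(t) = a Df(x) + t^-1 (Df(gam t) - Df(x)), and q(t)
   lies in the span of Df(x) and Df(gam t), the row space of the double matrix at
   (x, gam t).  If that matrix has generic rank, (x, gam t, q(t)) is a point of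
   the set whose closure is Projan.  Otherwise the generic rank is 2 and q(t) is
   a multiple of Df(x); then gam t is replaced by any y of C near 0 such that
   Df(y) is not a multiple of Df(x).

   The differentiability of Df comes from the power series of f: minus a
   polynomial, f(x + h) is a series of monomials of degree >= 3, whose increments
   satisfy |g(h) - g(k)| <= b |h - k| s^2 for |h|, |k| <= s.  This bounds g and
   its directional derivatives without differentiating the series term by
   term. *)

Set Implicit Arguments.
Unset Strict Implicit.
Unset Printing Implicit Defensive.

Import Order.TTheory GRing.Theory Num.Theory.
Import numFieldNormedType.Exports.

Local Open Scope classical_set_scope.
Local Open Scope ring_scope.

(** * Increments of monomials and partial sums over multi-indices *)

Lemma entry_norm_le (K : numFieldType) m n (A : 'M[K]_(m, n)) i j :
  `|A i j| <= `|A|.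
Proof.
apply/ler_addgt0Pr => e e0.
have : ball (0 : 'M[K]_(m, n)) (`|A| + e) A.
  by rewrite mx_norm_ball /ball_ /= sub0r normrN ltrDl.
by case=> _ /(_ i j); rewrite mxE /ball /= sub0r normrN => /ltW.
Qed.

Lemma norm_const_mx_le (K : numFieldType) m n (c : K) :
  `|const_mx c : 'M[K]_(m, n)| <= `|c|.
Proof.
have [->//|c0] := eqVneq `|const_mx c : 'M[K]_(m, n)| 0.
have [i ->] : exists i : 'I_m * 'I_n, `|const_mx c : 'M[K]_(m, n)| =
    `|(const_mx c : 'M[K]_(m, n)) i.1 i.2| by exact: mx_norm_neq0.
by rewrite mxE.
Qed.

(** Product rule for increments: the degrees [a] and [a'] add up while the bounds [b] and [b']
    multiply. Keeping the factor [s] on the left avoids exponents lowered by one, hence any separate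
    treatment of degree 0. *)
Lemma norm_subM_le (K : numFieldType) (s d x y b x' y' b' : K) (a a' : nat) :
  0 <= s -> `|x| <= b -> `|y'| <= b' ->
  `|x - y| * s <= a%:R * d * b -> `|x' - y'| * s <= a'%:R * d * b' ->
  `|x * x' - y * y'| * s <= (a + a')%:R * d * (b * b').
Proof.
move=> s0 xb yb' xy xy'.
have -> : x * x' - y * y' = x * (x' - y') + (x - y) * y' by ring.
have -> : (a + a')%:R * d * (b * b') =
    b * (a'%:R * d * b') + (a%:R * d * b) * b' by rewrite natrD; ring.
apply: (le_trans (ler_wpM2r s0 (ler_normD _ _))).
rewrite mulrDl !normrM -mulrA [X in _ + X]mulrAC.
by apply: lerD; apply: ler_pM; rewrite ?mulr_ge0.
Qed.

Definition mdeg (n : nat) (al : {ffun 'I_n -> nat}) : nat := \sum_(i < n) al i.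

Lemma mono_const (K : numFieldType) n (c : K) (al : {ffun 'I_n -> nat}) :
  mono (const_mx c) al = c ^+ mdeg al.
Proof.
rewrite /mono /mdeg expr_sum; apply: eq_bigr => i _; by rewrite mxE.
Qed.

Lemma mono_dist_le (K : numFieldType) n (h k : 'rV[K]_n) (s : K)
    (al : {ffun 'I_n -> nat}) :
  `|h| <= s -> `|k| <= s ->
  `|mono h al - mono k al| * s <= (mdeg al)%:R * `|h - k| * s ^+ mdeg al.
Proof.
move=> hs ks; have s0 : 0 <= s by exact: le_trans hs.
have es (l : 'rV[K]_n) i m : `|l| <= s -> `|l 0 i ^+ m| <= s ^+ m.
  move=> ls; rewrite normrX lerXn2r ?nnegrE//.
  exact: le_trans (entry_norm_le _ _ _) ls.
have ex i m : `|h 0 i ^+ m - k 0 i ^+ m| * s <= m%:R * `|h - k| * s ^+ m.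
  elim: m => [|m IH]; first by rewrite !expr0 subrr normr0 !mul0r.
  rewrite !exprS -[m.+1]add1n; apply: norm_subM_le => //.
  - by rewrite -[leLHS](congr1 _ (expr1 _)) (es h i 1%N).
  - exact: es.
  - rewrite mul1r ler_wpM2r//; apply: le_trans (entry_norm_le _ 0 i).
    by rewrite !mxE.
rewrite /mdeg expr_sum /mono.
suff : forall r : seq 'I_n,
    [/\ `|\prod_(i <- r) h 0 i ^+ al i| <= \prod_(i <- r) s ^+ al i,
        `|\prod_(i <- r) k 0 i ^+ al i| <= \prod_(i <- r) s ^+ al i &
     `|\prod_(i <- r) h 0 i ^+ al i - \prod_(i <- r) k 0 i ^+ al i| * s <=
      (\sum_(i <- r) al i)%:R * `|h - k| * \prod_(i <- r) s ^+ al i].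
  by move=> /(_ (index_enum 'I_n)) [].
elim=> [|i r [IH1 IH2 IH3]].
  by rewrite !big_nil subrr normr0 !mul0r normr1.
rewrite !big_cons !normrM; split.
- by apply: ler_pM => //; exact: es.
- by apply: ler_pM => //; exact: es.
- by apply: norm_subM_le => //; exact: es.
Qed.

(** Three powers of [s] are set aside, one of which cancels the factor [s] of [mono_dist_le]. In the
    rest, the degree [m] is absorbed by [m <= 2 ^ m = 8 * 2 ^ (m - 3)], and [2 * s <= rho] turns
    [(2 * s) ^ (m - 3)] into a power of [rho]. *)
Lemma mono_dist_le3 (K : numFieldType) n (h k : 'rV[K]_n) (s rho : K)
    (al : {ffun 'I_n -> nat}) :
  `|h| <= s -> `|k| <= s -> 0 < s -> s *+ 2 <= rho -> (3 <= mdeg al)%N ->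
  `|mono h al - mono k al| <= 8 / rho ^+ 3 * `|h - k| * s ^+ 2 * rho ^+ mdeg al.
Proof.
move=> hs ks s0 srho al3.
have rho0 : 0 < rho by apply: lt_le_trans srho; rewrite pmulrn_lgt0.
rewrite -(ler_pM2r s0); apply: le_trans (mono_dist_le _ hs ks) _.
set m := mdeg al in al3 *.
have key : m%:R * s ^+ m <= 8 / rho ^+ 3 * s ^+ 3 * rho ^+ m.
  have -> : 8 / rho ^+ 3 * s ^+ 3 * rho ^+ m = 8 * s ^+ 3 * rho ^+ (m - 3).
    rewrite -{1}(subnK al3) exprD.
    by field; rewrite gt_eqF.
  rewrite -{2}(subnK al3) exprD.
  have m2 : (m%:R : K) <= 8 * 2 ^+ (m - 3).
    rewrite -natrX -natrM ler_nat -[8%N]/(2 ^ 3)%N -expnD subnKC//.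
    by rewrite ltnW// ltn_expl.
  have sr : (2 * s) ^+ (m - 3) <= rho ^+ (m - 3).
    by rewrite lerXn2r ?nnegrE ?mulr_ge0 ?(ltW s0) ?(ltW rho0)// mulr_natl.
  apply: (@le_trans _ _ (8 * 2 ^+ (m - 3) * (s ^+ (m - 3) * s ^+ 3))).
    by rewrite ler_wpM2r// mulr_ge0// exprn_ge0// ltW.
  rewrite (_ : _ * _ = 8 * s ^+ 3 * (2 * s) ^+ (m - 3)); last first.
    by rewrite exprMn; ring.
  by rewrite ler_wpM2l// mulr_ge0// exprn_ge0// ltW.
have -> : m%:R * `|h - k| * s ^+ m = m%:R * s ^+ m * `|h - k| by ring.
have -> : 8 / rho ^+ 3 * `|h - k| * s ^+ 2 * rho ^+ m * s =
  8 / rho ^+ 3 * s ^+ 3 * rho ^+ m * `|h - k|.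
  by field; rewrite gt_eqF.
by rewrite ler_wpM2r.
Qed.

(** The cube of multi-indices bounded by [N] contains the cube bounded by [M.+1]. Every index left
    over has a component above [M], hence degree above [M]; this is what the remainder estimate
    needs. *)
Lemma psum_split (K : numFieldType) n (t : {ffun 'I_n -> nat} -> K) (M N : nat) :
  (M < N)%N ->
  psum t N = psum t M.+1 +
    \sum_(al : {ffun 'I_n -> 'I_N} | ~~ [forall i, (al i <= M)%N])
      t [ffun i => al i : nat].
Proof.
move=> MN; rewrite /psum (bigID (fun al : {ffun 'I_n -> 'I_N} =>
  [forall i, (al i <= M)%N])) /=; congr (_ + _).
pose wd (be : {ffun 'I_n -> 'I_M.+1}) : {ffun 'I_n -> 'I_N} :=
  [ffun i => widen_ord MN (be i)].
pose nr (al : {ffun 'I_n -> 'I_N}) : {ffun 'I_n -> 'I_M.+1} :=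
  [ffun i => inord (al i)].
rewrite (reindex_onto wd nr) => [|al /forallP alM]; last first.
  by apply/ffunP => i; apply/val_inj; rewrite !ffunE /= inordK ?ltnS.
apply: eq_big => [be|be _].
  rewrite (_ : nr (wd be) = be) ?eqxx ?andbT.
    by apply/forallP => i; rewrite ffunE /= -ltnS.
  by apply/ffunP => i; apply/val_inj; rewrite !ffunE /= inordK.
by congr t; apply/ffunP => i; rewrite !ffunE.
Qed.

(** * Polynomials are twice differentiable *)

Definition smooth2 (K : numFieldType) (V W : normedModType K) (f : V -> W) :=
  (forall x, differentiable f x) /\ (forall v x, differentiable ('D_v f) x).

Lemma smooth2_cst (K : numFieldType) (V W : normedModType K) (c : W) :
  smooth2 (cst c : V -> W).
Proof.
split=> [x|v x]; first exact: differentiable_cst.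
rewrite (_ : 'D_v _ = cst 0); first exact: differentiable_cst.
by apply/funext => y; rewrite derive_cst.
Qed.

Lemma derive_coord (K : numFieldType) m n i j (v x : 'M[K]_(m, n)) :
  'D_v (fun A : 'M[K]_(m, n) => A i j : K) x = v i j.
Proof.
apply: lim_near_cst => //; rewrite near_withinE.
apply: nearW => t t0 /=; rewrite !mxE addrK.
by rewrite /GRing.scale /= mulKf.
Qed.

Lemma smooth2_coord (K : numFieldType) m n i j :
  smooth2 (fun A : 'M[K]_(m, n) => A i j : K).
Proof.
split=> [x|v x]; first exact: differentiable_coord.
rewrite (_ : 'D_v _ = cst (v i j)); first exact: differentiable_cst.
by apply/funext => y; exact: derive_coord.
Qed.

Lemma smooth2D (K : numFieldType) (V W : normedModType K) (f g : V -> W) :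
  smooth2 f -> smooth2 g -> smooth2 (f + g).
Proof.
move=> [f1 f2] [g1 g2]; split=> [x|v x]; first exact: differentiableD.
rewrite (_ : 'D_v _ = 'D_v f + 'D_v g); first exact: differentiableD.
by apply/funext => y; rewrite deriveD//; exact: diff_derivable.
Qed.

Lemma smooth2M (K : numFieldType) (V : normedModType K) (f g : V -> K) :
  smooth2 f -> smooth2 g -> smooth2 (f * g).
Proof.
move=> [f1 f2] [g1 g2]; split=> [x|v x]; first exact: differentiableM.
rewrite (_ : 'D_v _ = f * 'D_v g + g * 'D_v f).
  by apply: differentiableD; apply: differentiableM.
by apply/funext => y; rewrite deriveM//; exact: diff_derivable.
Qed.

Lemma smooth2_psum_mono (K : numFieldType) n (a : {ffun 'I_n -> nat} -> K) N :
  smooth2 (fun h : 'rV[K]_n => psum (fun al => a al * mono h al) N).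
Proof.
have smooth2_prod (I : Type) (r : seq I) (F : I -> 'rV[K]_n -> K) :
    (forall i, smooth2 (F i)) -> smooth2 (fun h => \prod_(i <- r) F i h).
  move=> sF; elim: r => [|i r IH].
    by rewrite (_ : (fun _ => _) = cst 1);
      [exact: smooth2_cst | apply/funext => h; rewrite big_nil].
  rewrite (_ : (fun _ => _) = F i * (fun h => \prod_(i <- r) F i h)).
    exact: smooth2M.
  by apply/funext => h; rewrite big_cons.
have smooth2_sum (I : Type) (r : seq I) (F : I -> 'rV[K]_n -> K) :
    (forall i, smooth2 (F i)) -> smooth2 (fun h => \sum_(i <- r) F i h).
  move=> sF; elim: r => [|i r IH].
    by rewrite (_ : (fun _ => _) = cst 0);
      [exact: smooth2_cst | apply/funext => h; rewrite big_nil].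
  rewrite (_ : (fun _ => _) = F i + (fun h => \sum_(i <- r) F i h)).
    exact: smooth2D.
  by apply/funext => h; rewrite big_cons.
apply: smooth2_sum => al; set c := a _.
rewrite (_ : (fun _ => _) = cst c * (fun h => mono h [ffun i => al i : nat]))//.
apply: smooth2M; first exact: smooth2_cst.
apply: smooth2_prod => i; elim: (_ i) => [|m IH].
  by rewrite (_ : (fun _ => _) = cst 1);
    [exact: smooth2_cst | apply/funext => h; rewrite expr0].
rewrite (_ : (fun _ => _) = (fun h : 'rV[K]_n => h 0 i : K) * (fun h => h 0 i ^+ m)).
  by apply: smooth2M => //; exact: smooth2_coord.
by apply/funext => h; rewrite exprS.
Qed.

(** * Differentiability of power series and of their directional derivatives *)

Lemma power_series_remainder (K : numFieldType) n (f : 'rV[K]_n -> K)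
    (x : 'rV[K]_n) :
  has_power_series_at f x ->
  exists (p : 'rV[K]_n -> K) (b rho : K), [/\ smooth2 p, 0 <= b, 0 < rho &
    forall h k s, `|h| <= s -> `|k| <= s -> 0 < s -> s <= rho ->
      `|(f (x + h) - p h) - (f (x + k) - p k)| <= b * `|h - k| * s ^+ 2].
Proof.
case=> a /nbhs_normP [r /= r0 ar]; 
(* The index 3 collects the multi-indices with all components at most 2, so every monomial outside
   [p] has degree at least 3. Some monomials of higher degree also enter [p], which is harmless. *)
pose p h := psum (fun al => a al * mono h al) 3; exists p.
have near_ball h : `|h| < r -> ball_ Num.Def.normr (0 : 'rV[K]_n) r h.
  by rewrite /ball_ /= sub0r normrN.
(* The point with all coordinates [rho] lies in the ball of absolute convergence. There the term of
   index [al] has norm [|a al| * rho ^+ mdeg al], so [M] bounds the sums of these numbers uniformly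
   in [N]. *)
pose rho := r / 2.
have rho0 : 0 < rho by rewrite divr_gt0.
have [[M Mb] _] : (exists M : K, forall N,
    psum (fun al => `|a al * mono (const_mx rho) al|) N <= M) /\
    psum (fun al => a al * mono (const_mx rho) al) @ \oo --> f (x + const_mx rho).
  apply: ar; apply: near_ball; apply: le_lt_trans (norm_const_mx_le _ _ _) _.
  by rewrite gtr0_norm// ltr_pdivrMr// ltr_pMr// ltr1n.
have M0 : 0 <= M by apply: le_trans (Mb 0%N); rewrite /psum sumr_ge0.
(* The factor [8 / rho ^+ 3] comes from [mono_dist_le3], whose condition [s *+ 2 <= rho] explains
   the radius [rho / 2]. *)
exists (8 / rho ^+ 3 * M), (rho / 2); split.
- exact: smooth2_psum_mono.
- by rewrite mulr_ge0// divr_ge0// exprn_ge0// ltW.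
- by rewrite divr_gt0.
move=> h k s hs ks s0 srho.
have sr : s < r.
  apply: le_lt_trans srho _; rewrite /rho !ltr_pdivrMr// -mulrA ltr_pMr//.
  by rewrite -natrM ltr1n.
have hr : `|h| < r by exact: le_lt_trans sr.
have kr : `|k| < r by exact: le_lt_trans sr.
pose F l N := psum (fun al => a al * mono l al) N.
have Fl l : `|l| < r -> F l @ \oo --> f (x + l).
  by move=> /near_ball /ar [].
set B := _ * _ * s ^+ 2.
(* The bound is first proved for partial sums, uniformly in [N]: [p] cancels the small cube, and the
   tail is compared term by term with the series at [const_mx rho]. *)
have FB N : (2 < N)%N -> `|(F h N - p h) - (F k N - p k)| <= B.
  move=> N3; rewrite /F !(psum_split _ N3) -/(p h) -/(p k).
  rewrite ![p _ + _]addrC !addrK -sumrB.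
  apply: le_trans (ler_norm_sum _ _ _) _.
  apply: (@le_trans _ _ (\sum_(al : {ffun 'I_n -> 'I_N} | ~~ [forall i, (al i <= 2)%N])
     8 / rho ^+ 3 * `|h - k| * s ^+ 2 *
     `|a [ffun i => al i : nat] * mono (const_mx rho) [ffun i => al i : nat]|)).
    apply: ler_sum => al /forallPn [i al3]; rewrite -ltnNge in al3.
    rewrite -mulrBr !normrM mulrCA ler_wpM2l// mono_const normrX (gtr0_norm rho0).
    apply: (@mono_dist_le3 _ _ h k s rho) => //.
      by rewrite -mulr_natr -ler_pdivlMr.
    rewrite /mdeg (bigD1 i) //= ffunE; exact: leq_trans (leq_addr _ _).
  rewrite -mulr_sumr /B -![_ * M * _]mulrA [_ * (M * _)]mulrA.
  rewrite (_ : _ * M * _ * _ = 8 / rho ^+ 3 * `|h - k| * s ^+ 2 * M); last by ring.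
  rewrite ler_wpM2l//.
    by rewrite !mulr_ge0 ?exprn_ge0 ?invr_ge0 ?exprn_ge0 ?(ltW s0) ?(ltW rho0).
  apply: le_trans (Mb N).
  by rewrite /psum [leRHS](bigID (fun al : {ffun 'I_n -> 'I_N} =>
    ~~ [forall i, (al i <= 2)%N])) /= lerDl sumr_ge0.
(* Passage to the limit in [N], each of the two series contributing an error below [e / 2]. *)
apply/ler_addgt0Pl => e e0.
have e20 : 0 < e / 2 by rewrite divr_gt0.
have [N [N2 [hN kN]]] : exists N, (2 < N)%N /\
    `|f (x + h) - F h N| < e / 2 /\ `|f (x + k) - F k N| < e / 2.
  near \oo => N; exists N; split; [|split].
  - by near: N; exact: nbhs_infty_gt.
  - by near: N; move/cvgrPdist_lt : (Fl h hr); apply.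
  - by near: N; move/cvgrPdist_lt : (Fl k kr); apply.
have -> : (f (x + h) - p h) - (f (x + k) - p k) =
    ((f (x + h) - F h N) - (f (x + k) - F k N)) +
    ((F h N - p h) - (F k N - p k)) by ring.
apply: le_trans (ler_normD _ _) _; apply: lerD; last exact: FB.
apply: le_trans (ler_normB _ _) _.
by rewrite [leRHS]splitr; apply: lerD; exact: ltW.
Unshelve. all: by end_near.
Qed.

(** A quadratic increment is [o(h)], so the zero map is the differential. *)
Lemma differentiable_flat (K : numFieldType) (V W : normedModType K)
    (g : V -> W) (x : V) (b : K) :
  (\forall h \near (0 : V), `|g (h + x) - g x| <= b * `|h| ^+ 2) ->
  differentiable g x.
Proof.
move=> gb.
have dg : g \o shift x = cst (g x) + \0 +o_ 0 id.
  apply/eqaddoP => e e0; near=> h.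
  have -> : ((g \o shift x) - (cst (g x) + \0)) h = g (h + x) - g x.
    by rewrite !fctE /= addr0.
  have /le_trans -> // : `|g (h + x) - g x| <= b * `|h| ^+ 2.
    by near: h.
  have [->|h0] := eqVneq h 0; first by rewrite normr0 expr0n mulr0 mulr0.
  rewrite expr2 mulrA ler_wpM2r//.
  (* The sign of [b] is not given, and [b] might not even be real; for [h != 0] the assumed bound
     itself forces [0 <= b]. *)
  apply: (@le_trans _ _ (`|b| * `|h|)).
    have : 0 <= b * `|h| ^+ 2.
      by apply: le_trans (normr_ge0 (g (h + x) - g x)) _; near: h.
    rewrite pmulr_lge0 ?exprn_gt0 ?normr_gt0// => b0.
    by rewrite ger0_norm.
  have b1 : 0 < `|b| + 1 by rewrite ltr_wpDl.
  apply: (@le_trans _ _ ((`|b| + 1) * `|h|)).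
    by rewrite ler_wpM2r// lerDl.
  rewrite mulrC -ler_pdivlMr//.
  near: h; apply: nbhs0_le; exact: divr_gt0.
have c0 : continuous (\0 : V -> W) by exact: cst_continuous.
apply/diff_locallyP.
have d0 : 'd g x = \0 :> (V -> W) by exact: diff_unique.
by rewrite d0.
Unshelve. all: by end_near.
Qed.

Lemma smooth2_center (K : numFieldType) (V W : normedModType K) (f : V -> W) x :
  smooth2 f -> smooth2 (f \o center x).
Proof.
have dc y : differentiable (center x) y.
  apply: (@differentiableB _ _ _ id (cst x)) => //; exact: differentiable_cst.
move=> [f1 f2]; split=> [y|v y]; first exact: differentiable_comp.
rewrite (_ : 'D_v _ = 'D_v f \o center x); first exact: differentiable_comp.
apply/funext => z; rewrite /derive /=.
by under eq_fun do rewrite -addrA.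
Qed.

Lemma power_series_jet (K : numFieldType) n (f : 'rV[K]_n -> K)
    (x : 'rV[K]_n) :
  has_power_series_at f x ->
  exists (q : 'rV[K]_n -> K) (b rho : K), [/\ smooth2 q, 0 <= b, 0 < rho &
    forall h k s, `|h| <= s -> `|k| <= s -> 0 < s -> s <= rho ->
      `|(f \- q) (h + x) - (f \- q) (k + x)| <= b * `|h - k| * s ^+ 2].
Proof.
case/power_series_remainder => p [b [rho [sp b0 rho0 H]]].
exists (p \o center x), b, rho; split=> //; first exact: smooth2_center.
by move=> h k s; rewrite /= !addrK ![_ + x]addrC; exact: H.
Qed.

Lemma has_power_series_at_differentiable (K : numFieldType) n
    (f : 'rV[K]_n -> K) (x : 'rV[K]_n) :
  has_power_series_at f x -> differentiable f x.
Proof.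
case/power_series_jet => q [b [rho [sq b0 rho0 H]]].
rewrite (_ : f = (f \- q) + q); last by apply/funext => y; rewrite fctE /= subrK.
apply: differentiableD; last exact: sq.1.
(* Taking 0 as the second point and [s = |h|] bounds the increment by [b * |h| ^+ 3], and one factor
   [|h|] is at most [rho]. *)
apply: (@differentiable_flat _ _ _ _ _ (b * rho)); near=> h.
have hr : `|h| <= rho by near: h; exact: (@nbhs0_le K 'rV[K]_n).
have [->|h0] := eqVneq h 0; first by rewrite add0r subrr !normr0 expr0n mulr0.
rewrite -[x in _ - _ x]add0r; apply: le_trans (H _ _ `|h| _ _ _ hr) _ => //.
- by rewrite normr0.
- by rewrite normr_gt0.
- by rewrite subr0 ler_wpM2r ?exprn_ge0// ler_wpM2l.
Unshelve. all: by end_near.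
Qed.

(** The difference quotients have norm at most [c] near 0, and the bound passes to their limit. *)
Lemma derive_norm_le (K : numFieldType) (V W : normedModType K) (g : V -> W)
    (x v : V) (c : K) :
  derivable g x v ->
  (\forall t \near (0 : K)^', `|g (t *: v + x) - g x| <= c * `|t|) ->
  `|'D_v g x| <= c.
Proof.
move=> dg gc; apply/ler_addgt0Pl => e e0.
have /cvgrPdist_lt /(_ e e0) De := dg.
near (0 : K)^' => t.
have t0 : t != 0 by near: t; exact: nbhs_dnbhs_neq.
have qc : `|t^-1 *: (g (t *: v + x) - g x)| <= c.
  rewrite normrZ normfV mulrC ler_pdivrMr ?normr_gt0//.
  by near: t.
rewrite -[leLHS](congr1 _ (subrK (t^-1 *: (g (t *: v + x) - g x)) _)).
apply: le_trans (ler_normD _ _) _; apply: lerD qc; apply: ltW.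
by near: t.
Unshelve. all: by end_near.
Qed.

(** After subtracting the polynomial [q], the increments between [h] and [h + t v] bound the
    derivative of the remainder along [v] by [b * |v| * s ^+ 2] whenever [|h| < s]. With [s = 2 |h|]
    this is quadratic in [h], so [differentiable_flat] applies. Power series at the points near [x]
    make [f] differentiable there, which allows ['D_v (f \- q)] to be split. *)
Lemma holomorphic_derive_differentiable (K : numFieldType) n
    (f : 'rV[K]_n -> K) (x v : 'rV[K]_n) :
  holomorphic_near f x -> differentiable ('D_v f) x.
Proof.
move=> hf; have := nbhs_singleton hf.
case/power_series_jet => q [b [rho [sq b0 rho0 H]]].
have df : \forall h \near (0 : 'rV[K]_n), differentiable f (h + x).
  have : \forall y \near x, differentiable f y.
    by near=> y; apply: has_power_series_at_differentiable; near: y.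
  by rewrite (near_shift 0) subr0.
rewrite (_ : 'D_v f = ('D_v f \- 'D_v q) + 'D_v q); last first.
  by apply/funext => y; rewrite fctE /= subrK.
apply: differentiableD; last exact: sq.2.
have Dg h s : `|h| < s -> s <= rho -> differentiable f (h + x) ->
    `|('D_v f \- 'D_v q) (h + x)| <= b * `|v| * s ^+ 2.
  move=> hs srho dfh; rewrite /=.
  have s0 : 0 < s by exact: le_lt_trans hs.
  have dq : differentiable q (h + x) by exact: sq.1.
  rewrite -deriveB; [|exact: diff_derivable..].
  apply: derive_norm_le.
    by apply: diff_derivable; exact: differentiableB.
  (* The strict inequality [|h| < s] leaves room for [h + t v] in the ball of radius [s] when [t] is
     small; the 1 in [|v| + 1] covers [v = 0]. *)
  have sh : 0 < s - `|h| by rewrite subr_gt0.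
  have v1 : 0 < `|v| + 1 by rewrite ltr_wpDl.
  near=> t; rewrite addrA.
  apply: le_trans (H _ _ s _ _ _ _) _ => //; last 1 first.
  - by rewrite addrK normrZ; rewrite le_eqVlt; apply/orP; left; apply/eqP; ring.
  - apply: le_trans (ler_normD _ _) _; rewrite -lerBrDr normrZ.
    apply: (@le_trans _ _ (`|t| * (`|v| + 1))).
      by rewrite ler_wpM2l// lerDl.
    rewrite -ler_pdivlMr//; near: t; apply: nbhs_dnbhs; apply: (@nbhs0_le K K).
    exact: (divr_gt0 sh v1).
  - exact: ltW.
(* The values at [h + x] and at [x] are both bounded with [s = 2 |h|], whence [8 = 2 * 2 ^ 2]. *)
apply: (@differentiable_flat _ _ _ _ _ (b * `|v| * 8)); near=> h.
have [->|h0] := eqVneq h 0; first by rewrite add0r subrr !normr0 expr0n mulr0.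
have hh : `|h| < `|h| * 2 by rewrite ltr_pMr ?normr_gt0// ltr1n.
have hr : `|h| * 2 <= rho.
  by rewrite -ler_pdivlMr//; near: h; apply: (@nbhs0_le K 'rV[K]_n); rewrite divr_gt0.
apply: le_trans (ler_normB _ _) _.
rewrite [leRHS](_ : _ = b * `|v| * (`|h| * 2) ^+ 2 + b * `|v| * (`|h| * 2) ^+ 2); last by ring.
apply: lerD; first by apply: Dg => //; near: h.
rewrite -[X in `|_ X|](add0r x); apply: Dg => //.
  by rewrite normr0 mulr_gt0 ?normr_gt0.
by rewrite add0r; apply: has_power_series_at_differentiable; exact: nbhs_singleton hf.
Unshelve. all: by end_near.
Qed.

(** * The derivative of [Df f] along an arc *)

Lemma differentiable_rV (K : numFieldType) (V : normedModType K) n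
    (phi : V -> 'rV[K]_n) (x : V) :
  (forall j, differentiable (fun y => phi y 0 j) x) -> differentiable phi x.
Proof.
move=> dphi.
rewrite (_ : phi = \sum_(j < n) (fun y => phi y 0 j *: delta_mx 0 j)).
  by apply: differentiable_sum => j; exact: differentiableZl.
by apply/funext => y; rewrite fct_sumE [LHS]row_sum_delta.
Qed.

Lemma holomorphic_map_differentiable (K : numFieldType) m n
    (phi : 'rV[K]_m -> 'rV[K]_n) x :
  holomorphic_map_near phi x -> differentiable phi x.
Proof.
move=> hphi; apply: differentiable_rV => j.
by apply: has_power_series_at_differentiable; exact: nbhs_singleton (hphi j).
Qed.

(** This ties the entrywise second derivatives to the differential of [Df f]: [w *m D2f f x] becomes
    its derivative along [w]. *)
Lemma jacobian_Df (K : numFieldType) n (f : 'rV[K]_n -> K) x :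
  differentiable (Df f) x -> 'J (Df f) x = D2f f x.
Proof.
move=> dDf; apply/matrixP => i j.
rewrite [RHS]mxE.
have -> : (fun y => 'D_('e_j) f y) = (fun A : 'rV[K]_n => A 0 j : K) \o Df f.
  by apply/funext => y; rewrite /= mxE.
rewrite deriveE; last first.
  by apply: differentiable_comp dDf _; exact: differentiable_coord.
rewrite diff_comp//; last exact: differentiable_coord.
rewrite /= -deriveE; last exact: differentiable_coord.
by rewrite derive_coord -deriveE// deriveEjacobian// -rowE [RHS]mxE.
Qed.

Lemma Df_differentiable (K : numFieldType) n (f : 'rV[K]_n -> K) x :
  holomorphic_near f x -> differentiable (Df f) x.
Proof.
move=> hf; apply: differentiable_rV => j.
rewrite (_ : (fun _ => _) = 'D_('e_j) f).
  exact: holomorphic_derive_differentiable.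
by apply/funext => y; rewrite mxE.
Qed.

(** Chain rule for [Df f \o gam] at 0 in the direction [1%:M], along which the scalar [t] becomes
    the parameter [t%:M]. *)
Lemma Df_arc_cvg (K : numFieldType) n (f : 'rV[K]_n -> K)
    (gam : 'rV[K]_1 -> 'rV[K]_n) :
  holomorphic_map_near gam 0 -> holomorphic_near f (gam 0) ->
  (fun t : K => t^-1 *: (Df f (gam t%:M) - Df f (gam 0))) @ 0^' -->
    'J gam 0 *m D2f f (gam 0).
Proof.
move=> /holomorphic_map_differentiable dgam /Df_differentiable dDf.
have dc : differentiable (Df f \o gam) 0 by exact: differentiable_comp.
have -> : 'J gam 0 *m D2f f (gam 0) = 'D_(1%:M) (Df f \o gam) 0.
  rewrite deriveE// diff_comp//= -[in RHS]deriveE// deriveEjacobian//.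
  by rewrite jacobian_Df// -deriveE// deriveEjacobian// mul1mx.
have := diff_derivable (v := 1%:M) dc.
rewrite /derivable /derive /=.
by under eq_fun do rewrite addr0 scale_scalar_mx mulr1.
Qed.

(** * Points of the curve and secants in the row space of the double *)

Lemma germ_dim1_punctured_nbhs (K : numFieldType) n (C U : set 'rV[K]_n) :
  germ_dim C 1 -> nbhs (0 : 'rV[K]_n) U -> exists x, [/\ U x, C x & x != 0].
Proof.
move=> [_ regC] U0; have [x Ux [Cx]] := regC U U0.
have [x0|x0 _] := eqVneq x 0; last by exists x.
rewrite x0 in Ux Cx *; clear x x0.
case=> O [V [phi [psi [[_ O0] oV dphi phiV [psiK _]]]]].
have [v0 Vv0 phiv0] : (phi @` V) 0 by rewrite phiV.
have /differentiable_continuous cphi : differentiable phi v0.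
  by apply: holomorphic_map_differentiable; case: (dphi v0 Vv0).
have : nbhs v0 (V `&` phi @^-1` U).
  apply: filterI; first exact: open_nbhs_nbhs.
  by apply: cphi; rewrite phiv0.
move=> /nbhs_normP [r /= r0 rU].
(* Here the regular point found is 0 itself. Moving its parameter by a small nonzero [c] stays in
   [U], and the left inverse [psi] shows that the new point differs from 0. *)
pose c : 'rV[K]_1 := const_mx (r / 2).
have r20 : 0 < r / 2 by rewrite divr_gt0.
have [Vv Uv] : (V `&` phi @^-1` U) (v0 + c).
  apply: rU; rewrite /ball_ /= opprD addNKr normrN.
  apply: le_lt_trans (norm_const_mx_le _ _ _) _.
  by rewrite gtr0_norm// ltr_pdivrMr// ltr_pMr// ltr1n.
exists (phi (v0 + c)); split=> //.
  have : (phi @` V) (phi (v0 + c)) by exists (v0 + c).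
  by rewrite phiV => -[].
apply/eqP => phiv; have : v0 + c = v0.
  by rewrite -(psiK _ Vv) phiv -phiv0 psiK.
rewrite -[RHS]addr0 => /addrI /(congr1 (fun w : 'rV[K]_1 => w 0 0)).
by rewrite !mxE => /eqP; rewrite gt_eqF.
Qed.

Lemma rank_col_mx_le1 (K : fieldType) n (a b : 'rV[K]_n) :
  a != 0 -> (\rank (col_mx a b) <= 1)%N -> (b <= a)%MS.
Proof.
move=> a0 ab1.
have aab : (a <= col_mx a b)%MS by rewrite -addsmxE addsmxSl.
have bab : (b <= col_mx a b)%MS by rewrite -addsmxE addsmxSr.
have rk := mxrank_leqif_sup aab.
apply: submx_trans bab _; rewrite -rk.2 eqn_leq rk.1 /=.
by rewrite rank_rV a0.
Qed.

(** In the second alternative [q] lies in the row space of [JM_D f (x, z)] for every [z], so [y] can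
    later be exchanged for a better point. *)
Lemma conormal_span_secant (K : numFieldType) n (f : 'rV[K]_n -> K)
    (C W : set 'rV[K]_n) (x u : 'rV[K]_n) (e : K) :
  holomorphic_near f x -> Df f x != 0 -> nbhs x W -> 0 < e ->
  conormal_span f C x u ->
  exists y q, [/\ W y, C y, `|u - q| < e, (q <= JM_D f (x, y))%MS &
    (\rank (JM_D f (x, y)) = 2)%N \/ (q <= Df f x)%MS].
Proof.
move=> hf dfx Wx e0 [a [w [[gam [hgam gamx Cgam ->]] ->]]].
rewrite -gamx in hf dfx Wx *.
have t_cvg : (fun t : K => t%:M : 'rV[K]_1) @ 0 --> (0 : 'rV[K]_1).
  have := @scalel_continuous _ _ (1%:M : 'rV[K]_1) 0.
  rewrite /continuous_at scale0r.
  by under eq_fun do rewrite scale_scalar_mx mulr1.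
have gam_cvg : (fun t : K => gam t%:M) @ 0 --> gam 0.
  have := differentiable_continuous (holomorphic_map_differentiable hgam).
  exact: cvg_comp.
have /cvgrPdist_lt /(_ e e0) De := Df_arc_cvg hgam hf.
near (0 : K)^' => t.
have Wy : W (gam t%:M) by near: t; apply: nbhs_dnbhs; exact: (gam_cvg _ Wx).
have Cy : C (gam t%:M) by near: t; apply: nbhs_dnbhs; exact: (t_cvg _ Cgam).
have Dt : `|'J gam 0 *m D2f f (gam 0) -
  t^-1 *: (Df f (gam t%:M) - Df f (gam 0))| < e by near: t.
set y := gam t%:M in Wy Cy Dt *.
pose q := a *: Df f (gam 0) + t^-1 *: (Df f y - Df f (gam 0)).
have xyx : (Df f (gam 0) <= JM_D f (gam 0, y))%MS by rewrite -addsmxE addsmxSl.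
have xyy : (Df f y <= JM_D f (gam 0, y))%MS by rewrite -addsmxE addsmxSr.
exists y, q; split=> //.
- by rewrite opprD addrACA subrr add0r.
- by rewrite addmx_sub ?scalemx_sub// addmx_sub// eqmx_opp.
- have [rk|] := leqP (\rank (JM_D f (gam 0, y))) 1.
    right; have yx : (Df f y <= Df f (gam 0))%MS by exact: rank_col_mx_le1.
    by rewrite addmx_sub ?scalemx_sub// addmx_sub// eqmx_opp.
  by move=> rk; left; apply/eqP; rewrite eqn_leq rk rank_leq_row.
Unshelve. all: by end_near.
Qed.

Lemma nbhs_diag (T : topologicalType) (b : T) (U : set (T * T)) :
  nbhs (b, b) U -> exists2 W, nbhs b W & W `*` W `<=` U.
Proof.
move=> [[P Q] /= [Pb Qb] PQ]; exists (P `&` Q); first exact: filterI.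
by move=> [x y] [[Px _] [_ Qy]]; exact: PQ.
Qed.

(** Since [subspace_limit] compares unit vectors, [l] is normalized, approximated by some [u] in the
    conormal span at [x], then by a secant [q], and scaled back. *)
Lemma SpanHL_secant (K : numFieldType) n (f : 'rV[K]_n -> K)
    (C W Q : set 'rV[K]_n) (S : {vspace 'rV[K]_n}) (l : 'rV[K]_n) :
  holomorphic_near f 0 -> germ_dim C 1 -> smooth_along f C ->
  is_SpanHL f C S -> nbhs (0 : 'rV[K]_n) W -> l \in S -> l != 0 -> nbhs l Q ->
  exists x y q, [/\ W x /\ C x, W y /\ C y, Df f x != 0, Q q /\ q != 0 &
    (q <= JM_D f (x, y))%MS /\
    ((\rank (JM_D f (x, y)) = 2)%N \/ (q <= Df f x)%MS)].
Proof.
move=> hf dimC smC limS W0 lS l0 Ql.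
have nl0 : 0 < `|l| by rewrite normr_gt0.
have : nbhs l (Q `&` [set q | q != 0]).
  apply: filterI => //; apply/(@nbhs_normP K 'rV[K]_n); exists `|l| => // q /=.
  by apply: contraTneq => ->; rewrite subr0 ltxx.
move=> /nbhs_normP [e /= e0 eQ].
(* The two errors below [d], multiplied by [|l|], add up to less than [e]. *)
pose d := e / 2 / `|l|.
have d0 : 0 < d by rewrite !divr_gt0.
rewrite /smooth_along in smC.
(* Interiors are taken so that [W] is a neighbourhood of [x] and [f] is holomorphic near [x], not
   merely near 0. *)
have [x [[Wx [hfx [dfx Sx]]] Cx x0]] := germ_dim1_punctured_nbhs dimC
  (filterI (nbhs_interior W0) (filterI (nbhs_interior hf)
  (filterI smC (limS d d0)))).
have [_ /(_ (`|l|^-1 *: l))] := Sx Cx x0.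
case=> [||u Vu lu]; first exact: memvZ.
  by rewrite normrZ normfV normr_id mulVf// gt_eqF.
have [y [q [Wy Cy uq qxy rk]]] :=
  conormal_span_secant hfx (dfx Cx x0) Wx d0 Vu.
have [Qq q0] : (Q `&` [set q | q != 0]) (`|l| *: q).
  apply: eQ => /=.
  have -> : l - `|l| *: q = `|l| *: ((`|l|^-1 *: l - u) + (u - q)).
    by rewrite subrKA scalerBr scalerA mulfV ?gt_eqF// scale1r.
  rewrite normrZ normr_id (_ : e = `|l| * (d + d)); last first.
    by rewrite /d; field; rewrite gt_eqF.
  rewrite ltr_pM2l//; apply: le_lt_trans (ler_normD _ _) _; exact: ltrD.
exists x, y, (`|l| *: q); split=> //.
- by split=> //; exact: nbhs_singleton.
- exact: dfx.
- split; first exact: scalemx_sub.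
  by case: rk => [|qx]; [left | right; exact: scalemx_sub].
Qed.

(** * Generic rank and the fiber of [Projan] *)

Lemma Projan_SpanHL (K : numFieldType) n (f : 'rV[K]_n -> K)
    (C : set 'rV[K]_n) (S : {vspace 'rV[K]_n}) :
  holomorphic_near f 0 -> C 0 -> germ_dim C 1 -> smooth_along f C ->
  is_SpanHL f C S ->
  projectivization S `<=` fiber (Projan (C `*` C) (0, 0) (JM_D f)) (0, 0).
Proof.
move=> hf C0 dimC smC limS l [lS l0]; split=> //= B.
case=> [[P Q] /= [/nbhs_diag [W W0 WP] Ql] PQB].
suff [x [y [q [[Wx Cx] [Wy Cy] grk [Qq q0] qxy]]]] :
    exists x y q, [/\ W x /\ C x, W y /\ C y,
      generic_rank (C `*` C) (0, 0) (JM_D f) (\rank (JM_D f (x, y))),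
      Q q /\ q != 0 & (q <= JM_D f (x, y))%MS].
  by exists ((x, y), q); split; [split | apply: PQB; split=> //; exact: WP].
(* The double matrix has two rows, so its generic rank is 2 as soon as rank 2 occurs arbitrarily
   close to the origin. *)
have [P2|] := pselect (forall U : set 'rV[K]_n, nbhs (0 : 'rV[K]_n) U ->
    exists x y, [/\ U x /\ C x, U y /\ C y & \rank (JM_D f (x, y)) = 2%N]).
  have grk : generic_rank (C `*` C) (0, 0) (JM_D f) 2.
    split.
      exists (setT, setT) => [|z _ _]; last exact: rank_leq_row.
      by split; exact: filterT.
    move=> U /nbhs_diag [U' U'0 U'U].
    have [x [y [[Ux Cx] [Uy Cy] rk]]] := P2 U' U'0.
    by exists (x, y); split=> //; exact: U'U.
  have [x [y [q [Wx Wy dfx Qq [qxy rk]]]]] :=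
    SpanHL_secant hf dimC smC limS W0 lS l0 Ql.
  case: rk => [rk|qx]; first by exists x, y, q; rewrite rk.
  (* If no [z] worked, all covectors [Df f z] with [z] in [C] and [W] would be multiples of
     [Df f x], contradicting rank 2 at some pair [(x1, y1)] of such points. *)
  have [z [Wz rk]] : exists z, (W z /\ C z) /\ \rank (JM_D f (x, z)) = 2%N.
    have [x1 [y1 [Wx1 Wy1 rk1]]] := P2 W W0.
    apply: contrapT => noz.
    have sub z : W z /\ C z -> (Df f z <= Df f x)%MS.
      move=> Wz; apply: rank_col_mx_le1 => //; rewrite leqNgt; apply/negP => rk.
      by apply: noz; exists z; split=> //; apply/eqP; rewrite eqn_leq rk rank_leq_row.
    have : (\rank (JM_D f (x1, y1)) <= \rank (Df f x))%N.
      by apply: mxrankS; rewrite col_mx_sub !sub.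
    by rewrite rk1 rank_rV dfx.
  exists x, z, q; rewrite rk; split=> //; apply: submx_trans qx _.
  by rewrite -addsmxE addsmxSl.
move=> /existsNP [U /not_implyP [U0 noU]].
(* In the remaining case the rank is at most 1 over [U], and equal to 1 where the first covector is
   nonzero; the pair carrying the secant then has generic rank without any exchange. *)
have rk1 x y : U x -> C x -> U y -> C y -> (\rank (JM_D f (x, y)) <= 1)%N.
  move=> Ux Cx Uy Cy; rewrite leqNgt; apply/negP => rk; apply: noU.
  by exists x, y; split=> //; apply/eqP; rewrite eqn_leq rk rank_leq_row.
have rkE x y : U x -> C x -> U y -> C y -> Df f x != 0 ->
    \rank (JM_D f (x, y)) = 1%N.
  move=> Ux Cx Uy Cy dfx; apply/eqP; rewrite eqn_leq rk1//=.
  have : (\rank (Df f x) <= \rank (JM_D f (x, y)))%N.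
    by apply: mxrankS; rewrite -addsmxE addsmxSl.
  by rewrite rank_rV dfx.
have [x [y [q [[[Wx Ux] Cx] [[Wy Uy] Cy] dfx Qq [qxy _]]]]] :=
  SpanHL_secant hf dimC smC limS (filterI W0 U0) lS l0 Ql.
exists x, y, q; split=> //; rewrite rkE//; split.
  exists (U, U) => //= -[x1 y1] [/= Ux1 Uy1] [Cx1 Cy1]; exact: rk1.
move=> V /nbhs_diag [V' V'0 V'V].
rewrite /smooth_along in smC.
(* Diagonal points [(z, z)] with [z != 0] attain rank 1 arbitrarily close to the origin. *)
have [z [[V'z [Uz dfz]] Cz z0]] :=
  germ_dim1_punctured_nbhs dimC (filterI V'0 (filterI U0 smC)).
by exists (z, z); split=> //; [exact: V'V | apply: rkE => //; exact: dfz].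
Qed.

Theorem theorem3p2 (R : realType) (n : nat)
  (f : 'rV[CC R]_n -> CC R) (C : set 'rV[CC R]_n)
  (SpanHL : {vspace 'rV[CC R]_n})
  (f_eq : hypersurface_equation f)
  (C_curve : irreducible_curve_germ C)
  (C_sub_X : germ_sub C [set x | f x = 0])
  (X_smooth : smooth_along f C)
  (SpanHL_lim : is_SpanHL f C SpanHL) :
  projectivization SpanHL `<=`
  fiber (Projan (C `*` C) (0, 0) (JM_D f)) (0, 0).
Proof.
have [hf _ _] := f_eq; have [[_ C0 _] dimC] := C_curve.
exact: Projan_SpanHL.
Qed.
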